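(* The following hold. (i) The sequence $(t_n)_{n\ge 1}$ increases, and the sequence $\left(\frac{t_n}{n}\right)_{n\ge 1}$ converges to $\ell$, the unique solution of the equation $$e^{\frac1\ell}-\frac{1}{\ell^2}-\frac{1}{\ell}-1=0.$$ Numerical computation gives $\ell\simeq 0.5577$. (ii) The sequence $(\alpha_n)_{n\ge 1}$ is bounded. Moreover, $\alpha_n$ converges to $\alpha$, where $$\alpha=\frac{\ell}{1+\ell+\ell^2}.$$ Numerically $\alpha\simeq 0.298438$. (iii) $$\max_{(n,t)\in\mathbb{N}\times(0,+\infty)}\tau(n,t)=\alpha.$$
   Context: For real $x\ge 1$ and $t\ge 0$ let $$\tau(x,t)=\frac1x\left(t-(t+x+1)\left(\frac{t}{1+t}\right)^{x+1}\right).$$ Here $\mathbb{N}$ denotes the set of integers $n\ge 1$. For each integer $n\ge 1$, $t_n$ denotes the unique point at which the function $t\mapsto\tau(n,t)$ attains its maximum on $(0,+\infty)$, and $\alpha_n:=\tau(n,t_n)=\max_{t>0}\tau(n,t)$.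
   Formalization: In (iii) the maximum is replaced by the supremum, since τ(n,t) < α always and α is not attained; the value α ≃ 0.298438 (true value about 0.298426) is stated with error below 2·10⁻⁵, and ℓ ≃ 0.5577 with error below 10⁻⁴. *)

(* Defs.v *)
From Stdlib Require Import Reals ClassicalEpsilon.
From Coquelicot Require Import Coquelicot.
Open Scope R_scope.

(* Stdlib's [Rpower 0 a] is [1]; here [0] to a positive power is [0]. *)
Definition rpow (b a : R) : R :=
  if Rlt_dec 0 b then Rpower b a else 0.

Definition tau (x t : R) : R :=
  1 / x * (t - (t + x + 1) * rpow (t / (1 + t)) (x + 1)).

Definition maximizes_tau (n : nat) (t : R) : Prop :=
  0 < t /\ forall s : R, 0 < s -> tau (INR n) s <= tau (INR n) t.

(* The value at [n = 0] is irrelevant: the sequences start at [n = 1]. *)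
Definition t_seq (n : nat) : R :=
  epsilon (inhabits 0) (unique (maximizes_tau n)).

Definition alpha_seq (n : nat) : R := tau (INR n) (t_seq n).

(* [l <> 0] is the domain of the equation; [1 / 0] is a junk value in Stdlib. *)
Definition ell_equation (l : R) : Prop :=
  l <> 0 /\ exp (1 / l) - 1 / l ^ 2 - 1 / l - 1 = 0.

(* Main.v *)
(* Put y = 1/t, m = n + 1, z = m y and u = 1/l, so that e^u = 1 + u + u^2.  The
   sign of the t-derivative of tau(n, t) is that of
     crit m y = (1 + y)^(m+1) - 1 - (m + 1) y - m^2 y^2,
   which is y^2 times an increasing function, hence has a single positive root
   y_m, and t_n = 1/y_m.  At y_m the value of tau is z / (1 + z + z^2 + z/m).
   Everything then follows from u <= m y_m <= u + 2/m (the upper bound for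
   m >= 6): the limits are immediate; crit (m+1) y_m = m y_m^2 (m y_m - 1) > 0
   gives y_(m+1) < y_m; and z / (1 + z + z^2) decreases for z >= 1.
   The bounds on m y_m come from Pade-type bounds on ln (1 + v). *)

Require Import Defs.
From Stdlib Require Import Reals Lra Lia Factorial ClassicalEpsilon.
From Coquelicot Require Import Coquelicot.
Open Scope R_scope.

(** * Bounds on [ln (1 + v)] for [v >= 0] *)

Lemma nonneg_of_derive (f f' : R -> R) (x : R) :
  (forall c, 0 <= c -> is_derive f c (f' c)) -> (forall c, 0 <= c -> 0 <= f' c) ->
  0 <= f 0 -> 0 <= x -> 0 <= f x.
Proof.
intros Hd Hpos H0 [Hx | <-]; [|assumption].
destruct (MVT_cor2 f f' 0 x Hx) as [c [Hc1 Hc2]].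
{ intros c Hc; apply is_derive_Reals, Hd; lra. }
assert (0 <= f' c) by (apply Hpos; lra).
assert (0 <= f' c * (x - 0)) by (apply Rmult_le_pos; lra).
lra.
Qed.

(** The right side is the Pade approximant of type (2, 1) at 0; the gap vanishes at 0 and has a
    nonnegative derivative. *)
Lemma ln_1p_le_pade (v : R) : 0 <= v -> ln (1 + v) <= v * (6 + v) / (6 + 4 * v).
Proof.
intros Hv; apply Rminus_le_0.
apply (nonneg_of_derive (fun v => v * (6 + v) / (6 + 4 * v) - ln (1 + v))
         (fun v => 4 * v ^ 3 / ((6 + 4 * v) ^ 2 * (1 + v)))); [| | |assumption].
- intros c Hc; auto_derive; [lra | field; lra].
- intros c Hc; apply Rdiv_le_0_compat; [|nra].
  pose proof (pow_le c 3 Hc); lra.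
- cbv beta; rewrite !Rplus_0_r, ln_1; lra.
Qed.

Lemma ln_1p_ge_quadratic (w : R) : 0 <= w -> w - w ^ 2 / 2 <= ln (1 + w).
Proof.
intros Hw; apply Rminus_le_0.
apply (nonneg_of_derive (fun w => ln (1 + w) - (w - w ^ 2 / 2))
         (fun w => w ^ 2 / (1 + w))); [| | |assumption].
- intros c Hc; auto_derive; [lra | field; lra].
- intros c Hc; apply Rdiv_le_0_compat; nra.
- cbv beta; rewrite !Rplus_0_r, ln_1; lra.
Qed.

(** Here the Pade approximant of type (1, 1) bounds the logarithm from below. *)
Lemma ln_1p_ge_pade (v : R) : 0 <= v -> 2 * v / (2 + v) <= ln (1 + v).
Proof.
intros Hv; apply Rminus_le_0.
apply (nonneg_of_derive (fun v => ln (1 + v) - 2 * v / (2 + v))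
         (fun v => v ^ 2 / ((1 + v) * (2 + v) ^ 2))); [| | |assumption].
- intros c Hc; auto_derive; [lra | field; lra].
- intros c Hc; apply Rdiv_le_0_compat; [nra|].
  apply Rmult_lt_0_compat; [lra|apply pow_lt; lra].
- cbv beta; rewrite !Rplus_0_r, ln_1; lra.
Qed.

(** * Taylor bounds on [exp] for nonnegative arguments *)

Definition exp_taylor (n : nat) (x : R) : R :=
  sum_f_R0 (fun k => x ^ k / INR (fact k)) n.

Lemma exp_taylor_0 (n : nat) : exp_taylor n 0 = 1.
Proof.
unfold exp_taylor; induction n as [|n IH]; [simpl; field|].
rewrite tech5, IH, pow_i by lia; unfold Rdiv; rewrite !Rmult_0_l; lra.
Qed.

Lemma is_derive_exp_monomial (n : nat) (x : R) :
  is_derive (fun x => x ^ S n / INR (fact (S n))) x (x ^ n / INR (fact n)).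
Proof.
rewrite fact_simpl, mult_INR.
assert (INR (S n) <> 0) by (apply not_0_INR; lia).
assert (INR (fact n) <> 0) by apply INR_fact_neq_0.
generalize dependent (INR (fact n)); intros F HF.
auto_derive; [exact I|].
change (match n with 0%nat => 1 | S _ => INR n + 1 end) with (INR (S n)).
field; split; assumption.
Qed.

Lemma is_derive_exp_taylor (n : nat) (x : R) :
  is_derive (exp_taylor (S n)) x (exp_taylor n x).
Proof.
induction n as [|n IH].
- unfold exp_taylor; simpl sum_f_R0; auto_derive; [exact I|simpl; field].
- apply (is_derive_plus (exp_taylor (S n))
           (fun x => x ^ S (S n) / INR (fact (S (S n))))); [exact IH|].
  apply is_derive_exp_monomial.
Qed.

Lemma exp_taylor_le (n : nat) (x : R) : 0 <= x -> exp_taylor n x <= exp x.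
Proof.
revert x; induction n as [|n IH]; intros x Hx.
- unfold exp_taylor; simpl; pose proof (exp_ineq1_le x); lra.
- apply Rminus_le_0.
  apply (nonneg_of_derive (fun x => exp x - exp_taylor (S n) x)
           (fun x => exp x - exp_taylor n x)); [| | |assumption].
  + intros c Hc; apply (is_derive_minus exp (exp_taylor (S n))).
    * apply is_derive_exp.
    * apply is_derive_exp_taylor.
  + intros c Hc; specialize (IH c Hc); lra.
  + cbv beta; rewrite exp_taylor_0, exp_0; lra.
Qed.

(** This is the Lagrange remainder with the intermediate exponential replaced by [exp x].
    Differentiating the gap at degree [n + 1] gives the gap at degree [n] plus a nonnegative term,
    hence the induction. *)
Lemma exp_le_taylor (n : nat) (x : R) : 0 <= x ->
  exp x <= exp_taylor n x + x ^ S n / INR (fact (S n)) * exp x.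
Proof.
revert x; induction n as [|n IH]; intros x Hx; apply Rminus_le_0.
- apply (nonneg_of_derive
           (fun x => exp_taylor 0 x + x ^ 1 / INR (fact 1) * exp x - exp x)
           (fun x => x * exp x)); [| | |assumption].
  + intros c Hc; unfold exp_taylor; simpl sum_f_R0; auto_derive;
      [exact I|simpl; field].
  + intros c Hc; pose proof (exp_pos c); nra.
  + cbv beta; rewrite exp_taylor_0, exp_0, pow_i by lia; lra.
- apply (nonneg_of_derive
           (fun x => exp_taylor (S n) x + x ^ S (S n) / INR (fact (S (S n))) * exp x - exp x)
           (fun x => exp_taylor n x + (x ^ S n / INR (fact (S n)) * exp x
                       + x ^ S (S n) / INR (fact (S (S n))) * exp x) - exp x));
    [| | |assumption].
  + intros c Hc.
    apply (is_derive_minus (fun x => exp_taylor (S n) x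
                             + x ^ S (S n) / INR (fact (S (S n))) * exp x) exp);
      [|apply is_derive_exp].
    apply (is_derive_plus (exp_taylor (S n))); [apply is_derive_exp_taylor|].
    apply (is_derive_mult (fun x => x ^ S (S n) / INR (fact (S (S n)))) exp);
      [apply is_derive_exp_monomial|apply is_derive_exp|intros; apply Rmult_comm].
  + intros c Hc; specialize (IH c Hc).
    assert (0 <= c ^ S (S n) / INR (fact (S (S n))) * exp c); [|lra].
    apply Rmult_le_pos; [|left; apply exp_pos].
    apply Rdiv_le_0_compat; [apply pow_le, Hc|apply INR_fact_lt_0].
  + cbv beta; rewrite exp_taylor_0, exp_0, pow_i by lia; unfold Rdiv; rewrite !Rmult_0_l; lra.
Qed.

(* The factorials are split into factors first: [simpl] would expand [INR (fact k)] in unary. *)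
Ltac expand_exp_taylor :=
  unfold exp_taylor; simpl sum_f_R0;
  rewrite ?fact_simpl, ?mult_INR; simpl fact; simpl INR; simpl pow.

(** Brings arguments near 1.79 below 1/2, where degree 7 is precise enough. *)
Lemma exp_pow4 (x : R) : exp x = exp (x / 4) ^ 4.
Proof. simpl; rewrite Rmult_1_r, <- !exp_plus; f_equal; field. Qed.

(** * Location and uniqueness of the nonzero root [u = 1/l] *)

Definition ell_fun (u : R) : R := exp u - u ^ 2 - u - 1.

Lemma ell_fun_neg : ell_fun (17932 / 10000) < 0.
Proof.
unfold ell_fun; rewrite exp_pow4.
pose proof (exp_le_taylor 7 (17932 / 10000 / 4) ltac:(lra)) as H.
revert H; expand_exp_taylor; intros H.
set (e := exp _) in *.
assert (He : 0 < e) by apply exp_pos.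
(* [H] bounds [e] by a constant plus a small multiple of [e]; being linear, it can be solved for
   [e]. *)
assert (He' : e < 1565651 / 1000000) by lra.
pose proof (pow_incr e (1565651 / 1000000) 4 ltac:(lra)).
lra.
Qed.

Lemma ell_fun_pos : 0 < ell_fun (17933 / 10000).
Proof.
unfold ell_fun; rewrite exp_pow4.
pose proof (exp_taylor_le 7 (17933 / 10000 / 4) ltac:(lra)) as H.
revert H; expand_exp_taylor; intros H.
set (e := exp _) in *.
assert (He : 1565687 / 1000000 < e) by lra.
pose proof (pow_incr (1565687 / 1000000) e 4 ltac:(lra)).
lra.
Qed.

Lemma ell_fun_root_exists :
  exists u, 17932 / 10000 <= u <= 17933 / 10000 /\ ell_fun u = 0.
Proof.
destruct (IVT_cor ell_fun (17932 / 10000) (17933 / 10000)) as [u [Hu Hu0]].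
- unfold ell_fun; intros c; apply continuity_pt_filterlim.
  apply (ex_derive_continuous (fun u => exp u - u ^ 2 - u - 1)).
  auto_derive; exact I.
- lra.
- pose proof ell_fun_neg; pose proof ell_fun_pos; nra.
- exists u; split; assumption.
Qed.

(* Equals 1 exactly at the roots of [ell_fun], and has derivative [c (1 - c) e^(-c)]. *)
Definition ell_ratio (c : R) : R := (1 + c + c ^ 2) * exp (- c).

Lemma ell_ratio_eq1 (c : R) : ell_fun c = 0 -> ell_ratio c = 1.
Proof.
unfold ell_fun, ell_ratio; intros H.
replace (1 + c + c ^ 2) with (exp c) by lra.
rewrite <- exp_plus, Rplus_opp_r; apply exp_0.
Qed.

Lemma ell_ratio_mvt (a b : R) : a < b ->
  exists c, ell_ratio b - ell_ratio a = c * (1 - c) * exp (- c) * (b - a) /\ a < c < b.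
Proof.
intros Hab.
apply (MVT_cor2 ell_ratio (fun c => c * (1 - c) * exp (- c)) a b Hab).
intros c _; apply is_derive_Reals; unfold ell_ratio.
auto_derive; [exact I|ring].
Qed.

(** [ell_ratio] is 1 at 0, decreases on the negative axis and increases on [[0, 1]], so it exceeds 1
    at every nonzero point up to 1. *)
Lemma ell_fun_root_gt1 (c : R) : c <> 0 -> ell_fun c = 0 -> 1 < c.
Proof.
intros Hc Hroot; apply ell_ratio_eq1 in Hroot.
assert (H0 : ell_ratio 0 = 1) by (unfold ell_ratio; rewrite Ropp_0, exp_0; ring).
destruct (Rlt_or_le 1 c) as [|Hle]; [assumption|exfalso].
destruct (Rdichotomy _ _ Hc) as [Hneg|Hpos].
- destruct (ell_ratio_mvt c 0 Hneg) as [d [Hd Hd']].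
  pose proof (exp_pos (- d)).
  assert (0 < - d * (1 - d) * exp (- d) * (0 - c)); [|lra].
  repeat apply Rmult_lt_0_compat; lra.
- destruct (ell_ratio_mvt 0 c Hpos) as [d [Hd Hd']].
  pose proof (exp_pos (- d)).
  assert (0 < d * (1 - d) * exp (- d) * (c - 0)); [|lra].
  repeat apply Rmult_lt_0_compat; lra.
Qed.

(** Both roots exceed 1, where [ell_ratio] strictly decreases and so takes the value 1 at most
    once. *)
Lemma ell_fun_root_unique (a b : R) :
  a <> 0 -> b <> 0 -> ell_fun a = 0 -> ell_fun b = 0 -> a = b.
Proof.
assert (Hlt : forall a b, a <> 0 -> ell_fun a = 0 -> ell_fun b = 0 -> ~ a < b).
{ intros x y Hx Hfx Hfy Hxy.
  pose proof (ell_fun_root_gt1 x Hx Hfx).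
  apply ell_ratio_eq1 in Hfx; apply ell_ratio_eq1 in Hfy.
  destruct (ell_ratio_mvt x y Hxy) as [d [Hd Hd']].
  pose proof (exp_pos (- d)).
  assert (0 < d * (d - 1) * exp (- d) * (y - x)); [|lra].
  repeat apply Rmult_lt_0_compat; lra. }
intros Ha Hb Hfa Hfb.
destruct (Rtotal_order a b) as [H|[H|H]]; [|assumption|].
- elim (Hlt a b); assumption.
- elim (Hlt b a); assumption.
Qed.

Lemma unique_ell_equation (u : R) : u <> 0 -> ell_fun u = 0 -> unique ell_equation (/ u).
Proof.
intros Hu Hroot; split.
- split; [apply Rinv_neq_0_compat, Hu|].
  rewrite <- Hroot; unfold ell_fun.
  replace (1 / / u) with u by (field; assumption).
  field; assumption.
- intros l [Hl Heq].
  rewrite (ell_fun_root_unique u (/ l)); try assumption.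
  + apply Rinv_inv.
  + apply Rinv_neq_0_compat, Hl.
  + rewrite <- Heq; unfold ell_fun.
    replace (1 / l) with (/ l) by (field; assumption).
    field; assumption.
Qed.

(** * The critical polynomial and its positive root *)

Definition crit (m : nat) (y : R) : R :=
  (1 + y) ^ S m - 1 - (INR m + 1) * y - INR m ^ 2 * y ^ 2.

Lemma crit_S (m : nat) (y : R) :
  crit (S m) y = (1 + y) * crit m y + INR m * y ^ 2 * (INR m * y - 1).
Proof.
unfold crit; rewrite <- (tech_pow_Rmult (1 + y) (S m)), S_INR; ring.
Qed.

(** The terms of degree at least 3 of [(1 + y)^(m + 1)], divided by [y^2]: a polynomial with
    nonnegative coefficients, null at 0. The degree 2 terms of [crit] have coefficient
    [m (m + 1) / 2 - m^2 = - m (m - 1) / 2]. *)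
Fixpoint crit_quot (m : nat) (y : R) : R :=
  match m with
  | 0 => 0
  | S m => (1 + y) * crit_quot m y + y * (INR m * (INR m + 1) / 2)
  end.

Lemma crit_quotE (m : nat) (y : R) :
  crit m y = y ^ 2 * (crit_quot m y - INR m * (INR m - 1) / 2).
Proof.
induction m as [|m IH].
- unfold crit; simpl; field.
- rewrite crit_S, IH, S_INR; simpl crit_quot; field.
Qed.

Lemma crit_quot_ge0 (m : nat) (y : R) : 0 <= y -> 0 <= crit_quot m y.
Proof.
intros Hy; induction m as [|m IH]; simpl crit_quot; [lra|].
pose proof (pos_INR m).
apply Rplus_le_le_0_compat; apply Rmult_le_pos; nra.
Qed.

Lemma crit_quot_le (m : nat) (x y : R) :
  0 <= x <= y -> crit_quot m x <= crit_quot m y.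
Proof.
intros Hxy; induction m as [|m IH]; simpl crit_quot; [lra|].
pose proof (pos_INR m); pose proof (crit_quot_ge0 m x (proj1 Hxy)).
apply Rplus_le_compat; [apply Rmult_le_compat; lra|].
apply Rmult_le_compat_r; [nra|lra].
Qed.

(** [crit_quot 1] is identically 0; from [m = 2] on, the last term of the recursion is strictly
    increasing. *)
Lemma crit_quot_lt (m : nat) (x y : R) :
  (2 <= m)%nat -> 0 <= x < y -> crit_quot m x < crit_quot m y.
Proof.
intros Hm Hxy; destruct m as [|m]; [lia|]; simpl crit_quot.
assert (0 < INR m) by (apply lt_0_INR; lia).
pose proof (crit_quot_ge0 m x (proj1 Hxy)).
apply Rplus_le_lt_compat.
- apply Rmult_le_compat; try lra; apply crit_quot_le; lra.
- apply Rmult_lt_compat_r; [nra|lra].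
Qed.

(** Provides the right end of the interval containing the root. Equality holds at [m = 2], whose
    root is 1. *)
Lemma crit_quot_1_ge (m : nat) : (2 <= m)%nat -> INR m * (INR m - 1) / 2 <= crit_quot m 1.
Proof.
induction 1 as [|m Hm IH]; [simpl; lra|].
rewrite S_INR; simpl crit_quot.
assert (2 <= INR m) by (apply (le_INR 2); assumption); nra.
Qed.

Lemma crit_quot_continuous (m : nat) (y : R) : continuous (crit_quot m) y.
Proof.
induction m as [|m IH]; simpl crit_quot; [apply continuous_const|].
apply (continuous_plus (fun y => (1 + y) * crit_quot m y)
         (fun y => y * (INR m * (INR m + 1) / 2))).
- apply (continuous_mult (fun y => 1 + y) (crit_quot m)); [|exact IH].
  apply (continuous_plus (fun _ => 1) (fun y => y));
    [apply continuous_const|apply continuous_id].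
- apply (continuous_mult (fun y => y) (fun _ => INR m * (INR m + 1) / 2));
    [apply continuous_id|apply continuous_const].
Qed.

Definition crit_root (m : nat) (y : R) : Prop := 0 < y /\ crit m y = 0.

Lemma crit_root_exists (m : nat) : (2 <= m)%nat -> exists y, crit_root m y.
Proof.
intros Hm.
assert (H2 : 2 <= INR m) by (apply (le_INR 2); assumption).
pose proof (crit_quot_1_ge m Hm) as H1.
assert (H0 : crit_quot m 0 = 0).
{ clear; induction m as [|m IH]; simpl crit_quot; [reflexivity|].
  rewrite IH; ring. }
destruct (IVT_cor (fun y => crit_quot m y - INR m * (INR m - 1) / 2) 0 1) as [y [Hy Hy0]].
- intros y; apply continuity_pt_filterlim.
  apply (continuous_minus (crit_quot m) (fun _ => INR m * (INR m - 1) / 2));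
    [apply crit_quot_continuous|apply continuous_const].
- lra.
- cbv beta; rewrite H0.
  assert (0 <= INR m * (INR m - 1) / 2 * (crit_quot m 1 - INR m * (INR m - 1) / 2));
    [apply Rmult_le_pos; nra|lra].
- exists y; split.
  + destruct (proj1 Hy) as [|<-]; [assumption|exfalso; nra].
  + rewrite crit_quotE, Hy0; ring.
Qed.

Lemma crit_root_quot (m : nat) (y : R) : crit_root m y ->
  crit_quot m y = INR m * (INR m - 1) / 2.
Proof.
intros [Hy H0]; rewrite crit_quotE in H0.
apply Rmult_integral in H0; destruct H0 as [H0|H0]; [|lra].
exfalso; revert H0; apply pow_nonzero; lra.
Qed.

Lemma crit_neg_of_lt_root (m : nat) (x y : R) :
  (2 <= m)%nat -> crit_root m y -> 0 < x < y -> crit m x < 0.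
Proof.
intros Hm Hy Hx; rewrite crit_quotE, <- (crit_root_quot m y Hy).
pose proof (crit_quot_lt m x y Hm ltac:(lra)).
assert (0 < x ^ 2) by (apply pow_lt; lra); nra.
Qed.

Lemma crit_pos_of_gt_root (m : nat) (x y : R) :
  (2 <= m)%nat -> crit_root m y -> y < x -> 0 < crit m x.
Proof.
intros Hm Hy Hx; rewrite crit_quotE, <- (crit_root_quot m y Hy).
destruct Hy as [Hy _].
pose proof (crit_quot_lt m y x Hm ltac:(lra)).
assert (0 < x ^ 2) by (apply pow_lt; lra); nra.
Qed.

Lemma crit_root_ge (m : nat) (x y : R) :
  (2 <= m)%nat -> crit_root m y -> crit m x <= 0 -> x <= y.
Proof.
intros Hm Hy Hx; apply Rnot_lt_le; intros Hlt.
pose proof (crit_pos_of_gt_root m x y Hm Hy Hlt); lra.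
Qed.

Lemma crit_root_le (m : nat) (x y : R) :
  (2 <= m)%nat -> crit_root m y -> 0 < x -> 0 <= crit m x -> y <= x.
Proof.
intros Hm Hy H0 Hx; apply Rnot_lt_le; intros Hlt.
pose proof (crit_neg_of_lt_root m x y Hm Hy (conj H0 Hlt)); lra.
Qed.

(** * Two-sided bounds on [m] times the root of [crit m] *)

Lemma exp_le_compat (a b : R) : a <= b -> exp a <= exp b.
Proof. intros [H | ->]; [left; apply exp_increasing, H|apply Rle_refl]. Qed.

Lemma pow_exp_ln (n : nat) (b : R) : 0 < b -> b ^ n = exp (INR n * ln b).
Proof. intros Hb; rewrite <- Rpower_pow by assumption; reflexivity. Qed.

(** With [v = u / m] and [exp u = 1 + u + u^2], the claim reads [(1 + v)^(m + 1) <= exp u + v].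
    Taking logarithms, it is [(m + 1) ln (1 + v) <= u + ln (1 + v exp (- u))]; the left side is
    bounded by the Pade approximant, the right one by the quadratic bound. *)
Lemma crit_le0_at_ell (u : R) (m : nat) :
  17932 / 10000 <= u <= 17933 / 10000 -> ell_fun u = 0 -> (2 <= m)%nat ->
  crit m (u / INR m) <= 0.
Proof.
intros Hu Hroot Hm.
(* The logarithmic bounds used for [m >= 3] are not sharp enough for [m = 2]. *)
destruct (Nat.eq_dec m 2) as [->|Hm2].
{ unfold crit; simpl.
  set (v := u / (1 + 1)).
  assert (0 < v < 1) by (unfold v; lra).
  (* Here [crit 2 v = - v^2 (1 - v)]. *)
  assert (0 < v * v * (1 - v)) by (repeat apply Rmult_lt_0_compat; lra); lra. }
assert (H3 : 3 <= INR m) by (replace 3 with (INR 3) by (simpl; ring); apply le_INR; lia).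
set (v := u / INR m); unfold ell_fun in Hroot.
assert (Hmv : INR m * v = u) by (unfold v; field; lra).
assert (Hv : 0 < v <= 6 / 10).
{ split; [unfold v; apply Rdiv_lt_0_compat; lra|].
  apply Rmult_le_reg_l with (INR m); [lra|]; rewrite Hmv; lra. }
pose proof (exp_pos u) as HE.
enough (H : (1 + v) ^ S m <= exp u + v).
{ unfold crit.
  replace (INR m ^ 2 * v ^ 2) with ((INR m * v) ^ 2) by ring.
  replace ((INR m + 1) * v) with (INR m * v + v) by ring.
  rewrite Hmv; lra. }
assert (Hw : 0 < / exp u) by (apply Rinv_0_lt_compat, HE).
(* By the root equation [exp u = 1 + u + u^2], which is about 6.009. *)
assert (HEinv : 166 / 1000 <= / exp u <= 167 / 1000).
{ assert (exp u * / exp u = 1) by (field; lra). nra. }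
replace (exp u + v) with (exp (u + ln (1 + v * / exp u))).
2:{ rewrite exp_plus, exp_ln by nra; field; lra. }
rewrite pow_exp_ln by lra.
apply exp_le_compat, Rle_trans with ((u + v) * ((6 + v) / (6 + 4 * v))).
{ rewrite S_INR.
  apply Rle_trans with ((INR m + 1) * (v * (6 + v) / (6 + 4 * v))).
  - apply Rmult_le_compat_l; [lra|apply ln_1p_le_pade; lra].
  - right; rewrite <- Hmv; field; lra. }
pose proof (ln_1p_ge_quadratic (v * / exp u) ltac:(nra)) as Hln.
set (E := / exp u) in *.
assert ((u + v) * ((6 + v) / (6 + 4 * v)) - u <= v * E - (v * E) ^ 2 / 2); [|lra].
replace ((u + v) * ((6 + v) / (6 + 4 * v)) - u)
  with (v * ((6 + v - 3 * u) / (6 + 4 * v))) by (field; lra).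
replace (v * E - (v * E) ^ 2 / 2) with (v * (E - v * E ^ 2 / 2)) by field.
(* The factor [v] cancels; the remaining inequality has room to spare for [v <= 6/10], so crude
   decimal bounds on [E] suffice. *)
apply Rmult_le_compat_l; [lra|].
apply Rle_div_l; [lra|].
assert (E ^ 2 <= 28 / 1000) by nra.
assert (166 / 1000 - v * (14 / 1000) <= E - v * E ^ 2 / 2) by nra.
nra.
Qed.

(** The Pade lower bound gives the exponent [c (2 m + 2) / (2 m + c)], which is at least [c] because
    [c <= 2]. *)
Lemma exp_le_pow_1p (c : R) (m : nat) :
  0 <= c <= 2 -> (1 <= m)%nat -> exp c <= (1 + c / INR m) ^ S m.
Proof.
intros Hc Hm.
assert (H1 : 1 <= INR m) by (apply (le_INR 1); assumption).
assert (Hv : 0 <= c / INR m) by (apply Rdiv_le_0_compat; lra).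
rewrite pow_exp_ln, S_INR by lra.
apply exp_le_compat, Rle_trans with ((INR m + 1) * (2 * (c / INR m) / (2 + c / INR m))).
- replace ((INR m + 1) * (2 * (c / INR m) / (2 + c / INR m)))
    with (c * ((INR m + 1) * 2 / (2 * INR m + c))) by (field; split; lra).
  rewrite <- (Rmult_1_r c) at 1.
  apply Rmult_le_compat_l; [lra|apply Rle_div_r; lra].
- apply Rmult_le_compat_l; [lra|apply ln_1p_ge_pade, Hv].
Qed.

Lemma crit_ge_ell_fun (c : R) (m : nat) :
  0 <= c <= 2 -> (1 <= m)%nat -> ell_fun c - c / INR m <= crit m (c / INR m).
Proof.
intros Hc Hm; pose proof (exp_le_pow_1p c m Hc Hm) as H.
assert (H1 : 1 <= INR m) by (apply (le_INR 1); assumption).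
unfold ell_fun, crit.
replace (INR m ^ 2 * (c / INR m) ^ 2) with (c ^ 2) by (field; lra).
replace ((INR m + 1) * (c / INR m)) with (c + c / INR m) by (field; lra).
lra.
Qed.

(** The value 1/3 absorbs the error [2 / m] of [crit_ge_ell_fun] at [c = 2] as soon as [m >= 6]. *)
Lemma ell_fun_2_ge : 1 / 3 <= ell_fun 2.
Proof.
unfold ell_fun.
pose proof (exp_taylor_le 7 2 ltac:(lra)) as H.
revert H; expand_exp_taylor; intros H; lra.
Qed.

Lemma crit_root_lower (u : R) (m : nat) (y : R) :
  17932 / 10000 <= u <= 17933 / 10000 -> ell_fun u = 0 -> (2 <= m)%nat ->
  crit_root m y -> u <= INR m * y.
Proof.
intros Hu Hroot Hm Hy.
assert (2 <= INR m) by (apply (le_INR 2); assumption).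
pose proof (crit_root_ge m _ y Hm Hy (crit_le0_at_ell u m Hu Hroot Hm)) as H1.
apply Rmult_le_compat_l with (r := INR m) in H1; [|lra].
replace (INR m * (u / INR m)) with u in H1 by (field; lra); exact H1.
Qed.

(** A crude bound [z <= 2] for [z = m y] comes first, since [crit_ge_ell_fun] requires it. That
    lemma at [z] then gives [ell_fun z <= y <= 2 / m], and [ell_fun] grows at least like [z - u]. *)
Lemma crit_root_upper (u : R) (m : nat) (y : R) :
  17932 / 10000 <= u <= 17933 / 10000 -> ell_fun u = 0 -> (6 <= m)%nat ->
  crit_root m y -> INR m * y <= u + 2 * / INR m.
Proof.
intros Hu Hroot Hm Hy.
assert (H6 : 6 <= INR m) by (replace 6 with (INR 6) by (simpl; ring); apply le_INR, Hm).
assert (Hz2 : INR m * y <= 2).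
{ assert (Hle : y <= 2 / INR m).
  - apply (crit_root_le m); [lia|exact Hy|apply Rdiv_lt_0_compat; lra|].
    pose proof (crit_ge_ell_fun 2 m ltac:(lra) ltac:(lia)) as Hc.
    pose proof ell_fun_2_ge.
    assert (2 / INR m <= 1 / 3); [|lra].
    apply Rle_div_l; lra.
  - apply Rmult_le_compat_l with (r := INR m) in Hle; [|lra].
    replace (INR m * (2 / INR m)) with 2 in Hle by (field; lra); exact Hle. }
pose proof (crit_root_lower u m y Hu Hroot ltac:(lia) Hy) as Hz1.
destruct Hy as [Hy0 Hy].
pose proof (crit_ge_ell_fun (INR m * y) m ltac:(lra) ltac:(lia)) as Hc.
replace (INR m * y / INR m) with y in Hc by (field; lra).
rewrite Hy in Hc.
set (z := INR m * y) in *.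
(* Convexity of [exp] gives [ell_fun z >= (z - u) * (u ^ 2 - z)]. *)
assert (Hexp : exp u * (1 + (z - u)) <= exp z).
{ replace z with (u + (z - u)) at 2 by ring; rewrite exp_plus.
  apply Rmult_le_compat_l; [left; apply exp_pos|apply exp_ineq1_le]. }
assert (Hy2 : y <= 2 * / INR m).
{ apply Rmult_le_reg_l with (INR m); [lra|].
  replace (INR m * (2 * / INR m)) with 2 by (field; lra); exact Hz2. }
unfold ell_fun in *.
assert (HE : exp u = u ^ 2 + u + 1) by lra.
rewrite HE in Hexp.
(* [u^2 > 3] and [z <= 2]. *)
assert ((z - u) * 1 <= (z - u) * (u ^ 2 - z)) by (apply Rmult_le_compat_l; nra).
lra.
Qed.

Lemma crit_root_decr (u : R) (m : nat) (y y' : R) :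
  17932 / 10000 <= u <= 17933 / 10000 -> ell_fun u = 0 -> (2 <= m)%nat ->
  crit_root m y -> crit_root (S m) y' -> y' < y.
Proof.
intros Hu Hroot Hm Hy Hy'.
pose proof (crit_root_lower u m y Hu Hroot Hm Hy).
assert (2 <= INR m) by (apply (le_INR 2); assumption).
apply Rnot_le_lt; intros Hle.
assert (Hpos : 0 < crit (S m) y).
{ rewrite crit_S, (proj2 Hy); destruct Hy as [Hy _].
  assert (0 < INR m * y ^ 2 * (INR m * y - 1)); [|lra].
  repeat apply Rmult_lt_0_compat; lra. }
destruct Hle as [Hlt|<-].
- pose proof (crit_neg_of_lt_root (S m) y y' ltac:(lia) Hy' (conj (proj1 Hy) Hlt)); lra.
- rewrite (proj2 Hy') in Hpos; lra.
Qed.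

(** * The function [tau] in the variable [y = 1/t], and its maximizer *)

Definition tau_inv (n : nat) (y : R) : R :=
  (1 - (1 + INR (S n) * y) / (1 + y) ^ S n) / (INR n * y).

(** The base [t / (1 + t)] becomes [1 / (1 + y) > 0], so the real power is an integer power and the
    zero branch of [rpow] is excluded. *)
Lemma tau_Rinv (n : nat) (y : R) :
  (1 <= n)%nat -> 0 < y -> tau (INR n) (/ y) = tau_inv n y.
Proof.
intros Hn Hy.
assert (Hn1 : 1 <= INR n) by (apply (le_INR 1); assumption).
unfold tau, tau_inv, rpow.
replace (/ y / (1 + / y)) with (/ (1 + y)) by (field; lra).
destruct (Rlt_dec 0 (/ (1 + y))) as [Hb|Hb].
- rewrite <- S_INR, Rpower_pow, pow_inv, S_INR by assumption.
  field; repeat split; try lra; apply pow_nonzero; lra.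
- elim Hb; apply Rinv_0_lt_compat; lra.
Qed.

(** The minus sign reflects that [y = 1/t] reverses the order. *)
Lemma is_derive_tau_inv (n : nat) (y : R) : (1 <= n)%nat -> 0 < y ->
  is_derive (tau_inv n) y (- crit (S n) y / (INR n * y ^ 2 * (1 + y) ^ S (S n))).
Proof.
intros Hn Hy.
assert (Hn1 : 1 <= INR n) by (apply (le_INR 1); assumption).
unfold tau_inv, crit; rewrite S_INR, <- !tech_pow_Rmult.
apply (is_derive_ext (fun y => (1 - (1 + (INR n + 1) * y) * / ((1 + y) * (1 + y) ^ n))
                               / (INR n * y))).
{ intros t; reflexivity. }
(* Differentiating [(1 + y) ^ n] brings in the exponent [pred n]; with a successor, all powers
   reduce to a single atom [P]. *)
destruct n as [|n]; [lia|].
assert (HP : (1 + y) ^ n <> 0) by (apply pow_nonzero; lra).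
auto_derive; change (match n with 0%nat => 1 | S _ => INR n + 1 end) with (INR (S n)).
- repeat split; repeat apply Rmult_integral_contrapositive_currified;
    first [exact HP|lra].
- rewrite <- tech_pow_Rmult.
  generalize dependent ((1 + y) ^ n); intros P HP.
  field; repeat split; first [exact HP|lra].
Qed.

Lemma tau_inv_lt_root (n : nat) (x y : R) : (1 <= n)%nat -> crit_root (S n) y ->
  0 < x -> x <> y -> tau_inv n x < tau_inv n y.
Proof.
intros Hn Hy Hx Hxy.
assert (Hn1 : 1 <= INR n) by (apply (le_INR 1); assumption).
set (f' := fun y => - crit (S n) y / (INR n * y ^ 2 * (1 + y) ^ S (S n))).
assert (Hden : forall c, 0 < c -> 0 < INR n * c ^ 2 * (1 + c) ^ S (S n)).
{ intros c Hc; repeat apply Rmult_lt_0_compat; try lra; apply pow_lt; lra. }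
assert (Hder : forall a b, 0 < a -> forall c, a <= c <= b ->
                 derivable_pt_lim (tau_inv n) c (f' c)).
{ intros a b Ha c Hc; apply is_derive_Reals, is_derive_tau_inv; [exact Hn|lra]. }
pose proof (proj1 Hy) as Hy0.
destruct (Rdichotomy _ _ Hxy) as [Hlt|Hgt].
- destruct (MVT_cor2 (tau_inv n) f' x y Hlt (Hder x y Hx)) as [c [Hc Hc']].
  pose proof (crit_neg_of_lt_root (S n) c y ltac:(lia) Hy ltac:(lra)).
  assert (0 < f' c) by (apply Rdiv_lt_0_compat; [lra|apply Hden; lra]).
  nra.
- destruct (MVT_cor2 (tau_inv n) f' y x Hgt (Hder y x Hy0)) as [c [Hc Hc']].
  pose proof (crit_pos_of_gt_root (S n) c y ltac:(lia) Hy ltac:(lra)).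
  assert (0 < - f' c).
  { unfold f', Rdiv; rewrite <- Ropp_mult_distr_l, Ropp_involutive.
    apply Rdiv_lt_0_compat; [lra|apply Hden; lra]. }
  nra.
Qed.

Lemma unique_maximizes_tau (n : nat) (y : R) : (1 <= n)%nat -> crit_root (S n) y ->
  unique (maximizes_tau n) (/ y).
Proof.
intros Hn Hy; pose proof (proj1 Hy) as Hy0.
assert (Hlt : forall t, 0 < t -> t <> / y -> tau (INR n) t < tau (INR n) (/ y)).
{ intros t Ht Hty.
  rewrite <- (Rinv_inv t), !tau_Rinv by (assumption || apply Rinv_0_lt_compat, Ht).
  apply tau_inv_lt_root; try assumption; [apply Rinv_0_lt_compat, Ht|].
  intros <-; apply Hty; symmetry; apply Rinv_inv. }
split; [split|].
- apply Rinv_0_lt_compat, Hy0.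
- intros s Hs; destruct (Req_dec s (/ y)) as [->|Hne]; [lra|left; apply Hlt; assumption].
- intros t [Ht Hmax].
  destruct (Req_dec t (/ y)) as [->|Hne]; [reflexivity|].
  pose proof (Hlt t Ht Hne); pose proof (Hmax (/ y) (Rinv_0_lt_compat _ Hy0)); lra.
Qed.

(** [epsilon] satisfies its predicate since a witness exists; uniqueness then fixes its value. *)
Lemma t_seqE (n : nat) (y : R) : (1 <= n)%nat -> crit_root (S n) y -> t_seq n = / y.
Proof.
intros Hn Hy; pose proof (unique_maximizes_tau n y Hn Hy) as Hu.
assert (Hmax : unique (maximizes_tau n) (t_seq n)).
{ unfold t_seq; apply epsilon_spec; exists (/ y); exact Hu. }
symmetry; apply (proj2 Hu), (proj1 Hmax).
Qed.

(** The equation [crit (n + 1) y = 0] eliminates the power: [(1 + y)^(n + 1) = (1 + z + z^2 + y) /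
    (1 + y)]. The numerator becomes [z (z - y)], and [z - y = n y] cancels the denominator of
    [tau_inv]. *)
Lemma tau_inv_at_root (n : nat) (y : R) : (1 <= n)%nat -> crit_root (S n) y ->
  let z := INR (S n) * y in
  tau_inv n y = z / (1 + z + z ^ 2 + y).
Proof.
intros Hn [Hy H0]; unfold tau_inv.
assert (Hn1 : 1 <= INR n) by (apply (le_INR 1); assumption).
unfold crit in H0; rewrite <- tech_pow_Rmult in H0; rewrite S_INR in *.
assert (HP : (1 + y) ^ S n = (1 + (INR n + 1 + 1) * y + (INR n + 1) ^ 2 * y ^ 2) / (1 + y)).
{ apply Rmult_eq_reg_l with (1 + y); [|lra].
  replace ((1 + y) * ((1 + (INR n + 1 + 1) * y + (INR n + 1) ^ 2 * y ^ 2) / (1 + y)))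
    with (1 + (INR n + 1 + 1) * y + (INR n + 1) ^ 2 * y ^ 2) by (field; lra).
  lra. }
assert (0 < (INR n + 1 + 1) * y) by nra.
assert (0 <= (INR n + 1) ^ 2 * y ^ 2)
  by (apply Rmult_le_pos; apply pow2_ge_0).
rewrite HP; field; repeat split; nra.
Qed.

Lemma crit_root_t_seq (n : nat) : (1 <= n)%nat -> crit_root (S n) (/ t_seq n).
Proof.
intros Hn; destruct (crit_root_exists (S n)) as [y Hy]; [lia|].
rewrite (t_seqE n y Hn Hy), Rinv_inv; exact Hy.
Qed.

Lemma t_seq_pos (n : nat) : (1 <= n)%nat -> 0 < t_seq n.
Proof.
intros Hn; rewrite <- (Rinv_inv (t_seq n)).
apply Rinv_0_lt_compat, (crit_root_t_seq n Hn).
Qed.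

(** * The sequences expressed through [m y_m], where [m = n + 1] *)

Definition z_seq (n : nat) : R := INR (S n) * / t_seq n.

Lemma alpha_seqE (n : nat) : (1 <= n)%nat ->
  alpha_seq n = z_seq n / (1 + z_seq n + z_seq n ^ 2 + z_seq n * / INR (S n)).
Proof.
intros Hn; pose proof (crit_root_t_seq n Hn) as Hy.
unfold alpha_seq.
rewrite <- (Rinv_inv (t_seq n)) at 1.
rewrite tau_Rinv by (assumption || apply Hy).
rewrite (tau_inv_at_root n _ Hn Hy); fold (z_seq n).
replace (z_seq n * / INR (S n)) with (/ t_seq n); [reflexivity|].
unfold z_seq; field; split.
- apply not_0_INR; lia.
- pose proof (t_seq_pos n Hn); lra.
Qed.

Lemma is_lim_seq_Rinv_INR : is_lim_seq (fun n => / INR n) 0.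
Proof.
replace (Finite 0) with (Rbar_inv p_infty) by reflexivity.
apply is_lim_seq_inv; [apply is_lim_seq_INR|discriminate].
Qed.

Lemma is_lim_seq_Rinv_INR_S : is_lim_seq (fun n => / INR (S n)) 0.
Proof. apply (is_lim_seq_incr_1 (fun n => / INR n)), is_lim_seq_Rinv_INR. Qed.

Section Limits.

Variable u : R.
Hypothesis u_bounds : 17932 / 10000 <= u <= 17933 / 10000.
Hypothesis u_root : ell_fun u = 0.

Lemma z_seq_ge (n : nat) : (1 <= n)%nat -> u <= z_seq n.
Proof.
intros Hn; apply (crit_root_lower u (S n)); try assumption; [lia|].
apply crit_root_t_seq, Hn.
Qed.

Lemma is_lim_z_seq : is_lim_seq z_seq u.
Proof.
apply (is_lim_seq_le_le_loc (fun _ => u) _ (fun n => u + 2 * / INR (S n))).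
(* The upper bound needs [m >= 6], that is [n >= 5]. *)
- exists 5%nat; intros n Hn; split; [apply z_seq_ge; lia|].
  apply (crit_root_upper u (S n)); try assumption; [lia|].
  apply crit_root_t_seq; lia.
- apply is_lim_seq_const.
- replace (Finite u) with (Finite (u + 2 * 0)) by (f_equal; ring).
  apply is_lim_seq_plus'; [apply is_lim_seq_const|].
  apply is_lim_seq_mult'; [apply is_lim_seq_const|apply is_lim_seq_Rinv_INR_S].
Qed.

Lemma t_seq_incr (n : nat) : (1 <= n)%nat -> t_seq n < t_seq (S n).
Proof.
intros Hn.
rewrite <- (Rinv_inv (t_seq n)), <- (Rinv_inv (t_seq (S n))).
pose proof (crit_root_t_seq n Hn) as Hy.
pose proof (crit_root_t_seq (S n) ltac:(lia)) as Hy'.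
apply Rinv_lt_contravar; [apply Rmult_lt_0_compat; [apply Hy'|apply Hy]|].
apply (crit_root_decr u (S n)); try assumption; lia.
Qed.

Lemma is_lim_t_seq_ratio : is_lim_seq (fun n => t_seq n / INR n) (/ u).
Proof.
apply (is_lim_seq_ext_loc (fun n => (1 + / INR n) / z_seq n)).
- exists 1%nat; intros n Hn.
  assert (1 <= INR n) by (apply (le_INR 1); assumption).
  pose proof (t_seq_pos n Hn).
  unfold z_seq; rewrite S_INR; field; lra.
- replace (Finite (/ u)) with (Finite ((1 + 0) / u)) by (f_equal; field; lra).
  apply is_lim_seq_div'; [|apply is_lim_z_seq|lra].
  apply is_lim_seq_plus'; [apply is_lim_seq_const|apply is_lim_seq_Rinv_INR].
Qed.

Lemma is_lim_alpha_seq : is_lim_seq alpha_seq (u / (1 + u + u ^ 2)).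
Proof.
apply (is_lim_seq_ext_loc
  (fun n => z_seq n / (1 + z_seq n + z_seq n * z_seq n + z_seq n * / INR (S n)))).
- exists 1%nat; intros n Hn; rewrite alpha_seqE by exact Hn.
  f_equal; ring.
- replace (u / (1 + u + u ^ 2)) with (u / (1 + u + u * u + u * 0)) by (f_equal; ring).
  pose proof is_lim_z_seq as Hz.
  apply is_lim_seq_div'; [exact Hz| |nra].
  apply is_lim_seq_plus';
    [apply is_lim_seq_plus'; [apply is_lim_seq_plus'|]|].
  + apply is_lim_seq_const.
  + exact Hz.
  + apply is_lim_seq_mult'; exact Hz.
  + apply is_lim_seq_mult'; [exact Hz|apply is_lim_seq_Rinv_INR_S].
Qed.

Lemma alpha_seq_bounds (n : nat) : (1 <= n)%nat ->
  0 <= alpha_seq n <= u / (1 + u + u ^ 2).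
Proof.
intros Hn; rewrite alpha_seqE by exact Hn.
pose proof (z_seq_ge n Hn) as Hz; generalize dependent (z_seq n); intros z Hz.
assert (He : 0 < / INR (S n)) by (apply Rinv_0_lt_compat, lt_0_INR; lia).
assert (Hze : 0 < z * / INR (S n)) by (apply Rmult_lt_0_compat; lra).
assert (HD : 0 < 1 + u + u ^ 2) by nra.
assert (HDz : 0 < 1 + z + z ^ 2 + z * / INR (S n)) by nra.
split; [apply Rdiv_le_0_compat; lra|].
apply Rle_div_l; [exact HDz|].
replace (u / (1 + u + u ^ 2) * (1 + z + z ^ 2 + z * / INR (S n)))
  with (u * (1 + z + z ^ 2 + z * / INR (S n)) / (1 + u + u ^ 2))
  by (unfold Rdiv; ring).
apply Rle_div_r; [exact HD|].
(* With [m = n + 1], cross-multiplying leaves the difference [(z - u) (u z - 1) + u z / m]. *)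
assert (0 <= (z - u) * (u * z - 1)) by (apply Rmult_le_pos; nra).
assert (0 <= u * (z * / INR (S n))) by (apply Rmult_le_pos; lra).
nra.
Qed.

Lemma tau_le_alpha_seq (n : nat) (t : R) : (1 <= n)%nat -> 0 < t ->
  tau (INR n) t <= alpha_seq n.
Proof.
intros Hn Ht; pose proof (unique_maximizes_tau n _ Hn (crit_root_t_seq n Hn)) as Hu.
rewrite Rinv_inv in Hu; apply (proj2 (proj1 Hu)), Ht.
Qed.

(** A supremum and not an attained maximum: the term [z / m] in the denominator keeps each
    [alpha_seq n] strictly below the limit. It is the least bound because the values [alpha_seq n]
    converge to it. *)
Lemma is_lub_tau :
  is_lub (fun y : R => exists (n : nat) (t : R),
            (1 <= n)%nat /\ 0 < t /\ y = tau (INR n) t) (u / (1 + u + u ^ 2)).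
Proof.
split.
- intros y [n [t [Hn [Ht ->]]]].
  apply Rle_trans with (alpha_seq n);
    [apply tau_le_alpha_seq; assumption|apply alpha_seq_bounds, Hn].
- intros b Hb.
  apply (is_lim_seq_le_loc alpha_seq (fun _ => b) (u / (1 + u + u ^ 2)) b).
  + exists 1%nat; intros n Hn; apply Hb.
    exists n, (t_seq n); repeat split; [exact Hn|apply t_seq_pos, Hn].
  + apply is_lim_alpha_seq.
  + apply is_lim_seq_const.
Qed.

End Limits.

Theorem proposition2p4 :
  exists l : R, unique ell_equation l /\
  let alpha := l / (1 + l + l ^ 2) in
  (* (i) *)
  ((forall n : nat, (1 <= n)%nat -> t_seq n < t_seq (S n)) /\
   is_lim_seq (fun n : nat => t_seq n / INR n) l /\
   Rabs (l - 5577 / 10 ^ 4) < 1 / 10 ^ 4) /\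
  (* (ii) *)
  ((exists M : R, forall n : nat, (1 <= n)%nat -> Rabs (alpha_seq n) <= M) /\
   is_lim_seq alpha_seq alpha /\
   Rabs (alpha - 298438 / 10 ^ 6) < 2 / 10 ^ 5) /\
  (* (iii) *)
  is_lub (fun y : R => exists (n : nat) (t : R),
            (1 <= n)%nat /\ 0 < t /\ y = tau (INR n) t) alpha.
Proof.
destruct ell_fun_root_exists as [u [Hu Hroot]].
exists (/ u).
split; [apply unique_ell_equation; [lra|exact Hroot]|].
intros alpha.
(* The expression [l / (1 + l + l^2)] is invariant under [l -> 1/l]. *)
assert (Halpha : alpha = u / (1 + u + u ^ 2)) by (unfold alpha; field; nra).
clearbody alpha; rewrite Halpha; clear alpha Halpha.
repeat split.
- exact (t_seq_incr u Hu Hroot).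
- exact (is_lim_t_seq_ratio u Hu Hroot).
- assert (5576 / 10000 < / u < 5578 / 10000).
  { assert (u * / u = 1) by (field; lra); nra. }
  apply Rabs_def1; lra.
- exists (u / (1 + u + u ^ 2)); intros n Hn.
  pose proof (alpha_seq_bounds u Hu Hroot n Hn).
  rewrite Rabs_right; lra.
- exact (is_lim_alpha_seq u Hu Hroot).
- assert (298418 / 1000000 < u / (1 + u + u ^ 2) < 298458 / 1000000).
  { split; [apply -> Rlt_div_r|apply <- Rlt_div_l]; nra. }
  apply Rabs_def1; lra.
(* [repeat split] has also opened [is_lub] into its two halves. *)
- apply (is_lub_tau u Hu Hroot).
- apply (is_lub_tau u Hu Hroot).
Qed.
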